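(* Suppose $a$ and $b$ are orientation-preserving homeomorphisms of the circle $S^1$ with rational rotation numbers $\mathrm{Rot}(a)=p/q$ and $\mathrm{Rot}(b)=r/s$ in lowest non-negative terms, where (1) $b$ is not torsion, and (2) if $x\in \mathrm{Fix}(b^s)$ and $j\in\mathbb{Z}$ with $a^j\neq 1$, then $a^jx\notin \mathrm{Fix}(b^s)$. Then there is a positive integer $k$ such that $a$ and $b^k$ are a free basis for the group $\langle a,b^k\rangle$.
   Context: $S^1=\mathbb{R}/\mathbb{Z}$. An orientation-preserving homeomorphism $f$ of $S^1$ lifts to a homeomorphism $F$ of $\mathbb{R}$ with $F(x+m)=F(x)+m$ for all $x\in\mathbb{R}$, $m\in\mathbb{Z}$; its rotation number is $\mathrm{Rot}(f)=\lim_{n\to\infty}(F^n(x)-x)/n$, regarded as an element of $\mathbb{R}/\mathbb{Z}$ (rotation number zero is written $0/1$ in lowest non-negative terms). $\mathrm{Fix}(f)=\{x\in S^1: f\cdot x=x\}$ is the set of points fixed by $f$, $1$ is the identity map of $S^1$, homeomorphisms act on the left, and $\langle a,b^k\rangle$ is the group generated by $a$ and $b^k$ under composition.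
   Formalization: The free basis claim is made only when a is not torsion, since it fails for torsion a (e.g. a = 1, b non-torsion with a fixed point); in all cases, for the same k, the group ⟨a,b^k⟩ is shown to be the free product of ⟨a⟩ and ⟨b^k⟩. *)

(* Defs.v *)
From HB Require Import structures.
From mathcomp Require Import all_boot all_order all_algebra.
From mathcomp Require Import generic_quotient.
From mathcomp Require Import all_classical all_reals topology normedtype.

Set Implicit Arguments.
Unset Strict Implicit.
Unset Printing Implicit Defensive.

Import Order.TTheory GRing.Theory Num.Theory.
Import numFieldNormedType.Exports.

Local Open Scope classical_set_scope.
Local Open Scope ring_scope.
Local Open Scope quotient_scope.

Section Circle.
Variable R : realType.

Definition eqmodZ : rel R := fun x y => x - y \is a Num.int.

Lemma eqmodZ_equiv : equiv_class_of eqmodZ.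
Proof.
split=> [x | x y | y x z].
- by rewrite /eqmodZ subrr rpred0.
- by rewrite /eqmodZ -opprB rpredN.
- rewrite /eqmodZ => xy yz.
  have -> : x - z = (x - y) + (y - z) by rewrite addrA subrK.
  exact: rpredD xy yz.
Qed.

Definition eqmodZ_rel : equiv_rel R := EquivRelPack eqmodZ_equiv.

Definition circle : Type := quotient_topology {eq_quot eqmodZ_rel}.
HB.instance Definition _ := Topological.on circle.

Definition circle_proj (x : R) : circle := \pi_{eq_quot eqmodZ_rel} x.

Lemma circle_proj_eq (x y : R) :
  circle_proj x = circle_proj y <-> exists m : int, x = y + m%:~R.
Proof.
split=> [/(@eqmodP _ eqmodZ_rel)/intrP[m xy]|[m ->]].
  by exists m; rewrite -xy addrC subrK.
by apply/(@eqmodP _ eqmodZ_rel); rewrite /= /eqmodZ addrAC subrr add0r intr_int.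
Qed.

End Circle.

Definition homeomorphism (S T : topologicalType) (f : S -> T) : Prop :=
  continuous f /\ exists g : T -> S, [/\ continuous g, cancel f g & cancel g f].

(* An orientation-reversing homeomorphism of the circle only has lifts with
   F (x + m) = F x - m, so a homeomorphism having a lift in the sense below
   preserves orientation. *)
Definition is_lift (R : realType) (f : circle R -> circle R) (F : R -> R) :=
  [/\ homeomorphism F,
      forall (x : R) (m : int), F (x + m%:~R) = F x + m%:~R
    & forall x, f (circle_proj x) = circle_proj (F x)].

Record homeo_circle (R : realType) := HomeoCircle {
  hfun :> circle R -> circle R;
  hinv : circle R -> circle R;
  hfunK : cancel hfun hinv;
  hinvK : cancel hinv hfun;
  hfun_cont : continuous hfun;
  hinv_cont : continuous hinv;
  hfun_lift : exists F : R -> R, is_lift hfun F }.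

Section HomeoGroup.
Variable R : realType.
Notation H := (homeo_circle R).

Lemma homeo_circleP (f g : H) : hfun f =1 hfun g -> f = g.
Proof.
case: f => f f' fK f'K cf cf' Lf; case: g => g g' gK g'K cg cg' Lg /= /funext fg.
subst g; have e : f' = g' by apply/funext => x; rewrite -[in LHS](g'K x) fK.
subst g'; by congr HomeoCircle; exact: Prop_irrelevance.
Qed.

Lemma comp_cont (X Y Z : topologicalType) (f : X -> Y) (g : Y -> Z) :
  continuous f -> continuous g -> continuous (g \o f).
Proof. by move=> cf cg x; apply: continuous_comp; [exact: cf|exact: cg]. Qed.

Lemma homeomorphism_comp (X Y Z : topologicalType) (f : X -> Y) (g : Y -> Z) :
  homeomorphism f -> homeomorphism g -> homeomorphism (g \o f).
Proof.
move=> [cf [f' [cf' fK f'K]]] [cg [g' [cg' gK g'K]]]; split; first exact: comp_cont.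
by exists (f' \o g'); split; [exact: comp_cont|exact: can_comp|exact: can_comp].
Qed.

Lemma id_lift : is_lift (@id (circle R)) id.
Proof.
split=> //; split; first by move=> x; exact: cvg_id.
by exists id; split=> // x; exact: cvg_id.
Qed.

Lemma comp_lift (f g : circle R -> circle R) F G :
  is_lift f F -> is_lift g G -> is_lift (f \o g) (F \o G).
Proof.
move=> [hF FZ Ff] [hG GZ Gg]; split; first exact: homeomorphism_comp.
- by move=> x m; rewrite /= GZ FZ.
- by move=> x; rewrite /= Gg Ff.
Qed.

Lemma inv_lift (f : H) : exists F : R -> R, is_lift (hinv f) F.
Proof.
have [F [[cF [G [cG FK GK]]] FZ Ff]] := hfun_lift f.
exists G; split.
- by split=> //; exists F.
- by move=> x m; rewrite -[in LHS](GK x) -FZ FK.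
- by move=> x; rewrite -[in LHS](GK x) -Ff hfunK.
Qed.

Definition h_one : H :=
  @HomeoCircle R id id (fun=> erefl) (fun=> erefl) (fun x => @cvg_id _ (nbhs x))
    (fun x => @cvg_id _ (nbhs x)) (ex_intro _ _ id_lift).

Lemma mul_lift (f g : H) : exists F : R -> R, is_lift (hfun f \o hfun g) F.
Proof.
have [F LF] := hfun_lift f; have [G LG] := hfun_lift g.
by exists (F \o G); exact: comp_lift.
Qed.

Definition h_mul (f g : H) : H :=
  HomeoCircle (can_comp (hfunK f) (hfunK g)) (can_comp (hinvK g) (hinvK f))
    (comp_cont (@hfun_cont _ g) (@hfun_cont _ f))
    (comp_cont (@hinv_cont _ f) (@hinv_cont _ g)) (mul_lift f g).

Definition h_inv (f : H) : H :=
  HomeoCircle (hinvK f) (hfunK f) (@hinv_cont _ f) (@hfun_cont _ f) (inv_lift f).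

Lemma h_mulA : associative h_mul.
Proof. by move=> f g h; exact: homeo_circleP. Qed.
Lemma h_mul1 : left_id h_one h_mul.
Proof. by move=> f; exact: homeo_circleP. Qed.
Lemma h_1mul : right_id h_one h_mul.
Proof. by move=> f; exact: homeo_circleP. Qed.
Lemma h_mulV : left_inverse h_one h_inv h_mul.
Proof. by move=> f; apply: homeo_circleP => x; exact: hfunK. Qed.
Lemma h_Vmul : right_inverse h_one h_inv h_mul.
Proof. by move=> f; apply: homeo_circleP => x; exact: hinvK. Qed.

HB.instance Definition _ := gen_eqMixin H.
HB.instance Definition _ := gen_choiceMixin H.
HB.instance Definition _ :=
  isGroup.Build H h_mulA h_mul1 h_1mul h_mulV h_Vmul.

Lemma hmulE (f g : H) (x : circle R) : (f * g)%g x = f (g x).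
Proof. by []. Qed.

End HomeoGroup.

Definition Fix (R : realType) (f : homeo_circle R) : set (circle R) :=
  [set x | f x = x].

(* Rot f = rho: all lifts of f differ by integers, so t is determined by f
   modulo Z. *)
Definition has_rotation_number (R : realType) (f : homeo_circle R)
    (rho : circle R) : Prop :=
  exists (F : R -> R) (t : R),
    [/\ is_lift f F,
        forall x : R, ((iter n F x - x) / n%:R) @[n --> \oo] --> t
      & circle_proj t = rho].

Section FreeBasis.
Variable G : groupType.
Local Open Scope group_scope.

Definition zpow (x : G) (j : int) : G :=
  match j with Posz n => x ^+ n | Negz n => x ^- n.+1 end.

Definition torsion (x : G) : Prop := exists n : nat, (0 < n)%N /\ x ^+ n = 1.

Definition subgroup_set (K : set G) : Prop :=
  K 1 /\ forall x y : G, K x -> K y -> K (x / y).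

Definition generated (X : set G) : set G := smallest subgroup_set X.

(* A syllable (false, j) stands for x^j and a syllable (true, j) for y^j. *)
Definition syllable (x y : G) (s : bool * int) : G :=
  zpow (if s.1 then y else x) s.2.

Definition word_value (x y : G) (w : seq (bool * int)) : G :=
  \prod_(s <- w) syllable x y s.

Definition alternating (w : seq (bool * int)) : bool :=
  sorted (fun s t : bool * int => s.1 != t.1) w.

Definition free_basis (x y : G) (K : set G) : Prop :=
  generated [set x; y] = K /\
  forall w : seq (bool * int), w != [::] -> alternating w ->
    {in w, forall s, s.2 != 0%R} -> word_value x y w <> 1.

(* K is the free product of the cyclic groups <x> and <y>, of any orders.  A
   torsion element never belongs to a free basis of a free group, so this is the
   form of freeness that makes sense when x or y is torsion.  If neither is,
   syllable x y s <> 1 means s.2 != 0 and this is [free_basis]. *)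
Definition free_product_basis (x y : G) (K : set G) : Prop :=
  generated [set x; y] = K /\
  forall w : seq (bool * int), w != [::] -> alternating w ->
    {in w, forall s, syllable x y s <> 1} -> word_value x y w <> 1.

End FreeBasis.

(* Main.v *)
Require Import Defs.
From mathcomp Require Import all_boot all_order all_algebra.
From mathcomp Require Import all_classical all_reals topology normedtype.
From mathcomp Require Import realfun zify ring lra.

Set Implicit Arguments.
Unset Strict Implicit.
Unset Printing Implicit Defensive.

Import Order.TTheory GRing.Theory Num.Theory.
Import numFieldNormedType.Exports.

Local Open Scope classical_set_scope.
Local Open Scope ring_scope.

(** The free product is produced by ping-pong.  Let B be the set of points fixed
    by b^s.  A homeomorphism whose rotation number is a multiple of 1/s has
    an s-th power with a fixed point ([rotation_fixing_lift]), so B is not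
    empty, and likewise a^q has fixed points.

    Away from B, the iterates of b^s move a point monotonically along a lift, by
    steps bounded below, inside a gap of B; since a gap has length at most 1,
    after N steps every point that started away from B is close to B
    ([escape_to_Fix]).  Closeness is symmetric in the two ends of the orbit
    segment, so this covers negative powers as well.  Hence, for U the
    e-neighbourhood of B and k = s * N.+1, every power of b^k with a nonzero
    exponent maps the complement of U into U.

    In the other direction U has to be disjoint from all its translates a^j U
    with a^j <> 1 ([fatten_displaced]).  For a single j this is compactness,
    because a^j B and B are disjoint closed sets.  If a^q = 1 only finitely many
    j matter.  Otherwise the hypothesis forces B, and every a^i B, to be disjoint
    from the set of fixed points of a^q, and then the same escape lemma, applied
    to a^q, shows that a^j U is close to that set, hence disjoint from U, for all
    but finitely many j.

    The two inclusions and a point of B, which lies in U and is fixed by b^k,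
    are what [ping_pong] consumes. *)

(** * Neighbourhoods of a subset of the circle *)

Lemma near_right0_ex (R : realType) (P : R -> Prop) :
  (\forall e \near 0^'+, P e) -> exists2 e, 0 < e & P e.
Proof.
move=> nearP; near (0 : R)^'+ => e; exists e.
  by near: e; exact: nbhs_right_gt.
by near: e.
Unshelve. all: by end_near. Qed.

Section Neighbourhoods.
Variable R : realType.
Implicit Types (P Q : set (circle R)) (x y e : R) (z : circle R).

Lemma circle_projD x (m : int) : circle_proj (x + m%:~R) = circle_proj x.
Proof. by apply/circle_proj_eq; exists m. Qed.

Lemma circle_proj_surj z : exists2 x, 0 <= x <= 1 & circle_proj x = z.
Proof.
have [y <-] : exists y, circle_proj y = z.
  by exists (repr z); rewrite /circle_proj reprK.
exists (y - (Num.floor y)%:~R); last by rewrite -rmorphN circle_projD.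
rewrite subr_ge0 floor_le lerBlDl.
by rewrite -[X in _ + X]/(1%:~R) -intrD ltW// floorD1_gt.
Qed.

(** Compactness of the circle, in the form in which every uniform constant below
    is found: a property that holds near each point for small e holds everywhere
    for small e. *)
Lemma near_circle (Phi : R -> set (circle R)) :
    (forall x, \forall y \near x & e \near 0^'+, Phi e (circle_proj y)) ->
  \forall e \near 0^'+, forall z, Phi e z.
Proof.
move=> Phi_near.
have /compact_near_coveringP/(_ _ _ (fun e x => Phi e (circle_proj x))) :=
  @segment_compact R 0 1.
move=> /(_ (0^'+) _ (fun x _ => Phi_near x)).
apply: filterS => e Phi_e z; have [x x01 <-] := circle_proj_surj z.
by apply: Phi_e; rewrite /= in_itv.
Qed.

(** The open e-neighbourhood of P for the arc length metric; measuring in the real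
    line avoids putting a metric on the quotient. *)
Definition fatten P e : set (circle R) :=
  [set z | exists x p, [/\ z = circle_proj x, P (circle_proj p) & `|x - p| < e]].

Lemma fattenP P e x :
  fatten P e (circle_proj x) <-> exists2 p, P (circle_proj p) & `|x - p| < e.
Proof.
split=> [[y [p [/circle_proj_eq[m ->] Pp yp]]]|[p Pp xp]]; last by exists x, p.
by exists (p + m%:~R); rewrite ?circle_projD// opprD addrACA subrr addr0.
Qed.

Lemma subset_fatten P e e' : e <= e' -> fatten P e `<=` fatten P e'.
Proof. by move=> ee' z [x [p [-> Pp xp]]]; exists x, p; split=> //; lra. Qed.

Lemma fatten_self P e z : 0 < e -> P z -> fatten P e z.
Proof.
have [x _ <-] := circle_proj_surj z => e0 Px.
by apply/fattenP; exists x => //; rewrite subrr normr0.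
Qed.

(** Closedness read on the covering line; by definition of the quotient topology
    this is closedness in the circle. *)
Definition closedC P := closed (@circle_proj R @^-1` P).

Lemma fatten_avoid P x : closedC P -> ~ P (circle_proj x) ->
  \forall y \near x & e \near 0^'+, ~ fatten P e (circle_proj y).
Proof.
move=> cP Px; have : \forall y \near x, ~ P (circle_proj y).
  by apply: open_nbhs_nbhs; split=> //; exact: closed_openC.
move=> /nbhs_normP[d /= d0 dP].
have d20 : 0 < d / 2 by rewrite divr_gt0.
near=> y e => /fattenP[p Pp /= yp]; apply: (dP p) => //=.
have xy : `|x - y| < d / 2.
  by near: y; apply/nbhs_normP; exists (d / 2).
have e_small : e < d / 2 by near: e; exact: nbhs_right_lt.
rewrite (_ : x - p = (x - y) + (y - p)); last by lra.
by have := ler_normD (x - y) (y - p); lra.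
Unshelve. all: by end_near. Qed.

End Neighbourhoods.

(** * Lifts to the real line *)

Section Lifts.
Variable R : realType.
Implicit Types (f : homeo_circle R) (F : R -> R) (P Q : set (circle R)).

(** Near each point x, either x itself stays away from P, or f x stays away from
    Q; [near_circle] makes the distance uniform. *)
Lemma fatten_disjoint f P Q : closedC P -> closedC Q ->
    (forall z, P z -> ~ Q (f z)) ->
  \forall e \near 0^'+, forall z, fatten P e z -> ~ fatten Q e (f z).
Proof.
move=> cP cQ PQ; apply: near_circle => x.
have [F [[cF _] FZ fF]] := hfun_lift f.
have [Px|/(fatten_avoid cP)] := pselect (P (circle_proj x)); last first.
  by apply: filterS => -[y e] /= yP /yP.
have /(fatten_avoid cQ)[[U V] /= [UF V0] UV] : ~ Q (circle_proj (F x)).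
  by rewrite -fF; exact: PQ.
exists (F @^-1` U, V) => /=; first by split=> //; exact: cF.
by move=> -[y e] /= [Uy Ve] _; rewrite fF; exact: (UV (F y, e)).
Qed.

(** A continuous injection of the line is strictly monotone, and commuting with
    the translation by 1 excludes the decreasing case. *)
Lemma lift_mono f F : is_lift f F -> {mono F : x y / x <= y}.
Proof.
move=> [[cF [G [_ FK _]]] FZ _] x y.
have [//||up|down] := @itv_continuous_inj_mono R F `]-oo, +oo[.
- by apply: continuous_subspaceT.
- by move=> u v _ _ Fuv; rewrite -(FK u) Fuv FK.
- by apply: le_mono => u v uv; apply: up; rewrite ?in_itv.
- have := down (0 + 1%:~R) 0; rewrite !in_itv /= => /(_ isT isT).
  by rewrite FZ add0r ltr01 => /(_ isT); lra.
Qed.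

(** The displacement of a lift is continuous and 1-periodic, and vanishes only at
    its fixed points, so it is bounded below away from them. *)
Lemma displacement_ge f F e : is_lift f F -> 0 < e ->
  exists2 d, 0 < d & forall x,
    ~ fatten [set circle_proj p | p in [set p | F p = p]] e (circle_proj x) ->
    d <= `|F x - x|.
Proof.
move=> [[cF _] FZ _] e0; pose P := [set circle_proj p | p in [set p | F p = p]].
suff : \forall d \near 0^'+, forall z,
    forall x, circle_proj x = z -> ~ fatten P e z -> d <= `|F x - x|.
  by move=> /near_right0_ex[d d0 dFx]; exists d => // x; exact: (dFx _ x erefl).
apply: (@near_circle _ (fun d z => forall x, _)) => x.
have [Fx|Fx] := eqVneq (F x) x.
  near=> y d => y' _ []; apply/fattenP; exists x; first by exists x.
  by rewrite /= distrC; near: y; apply/nbhs_normP; exists e.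
have c0 : 0 < `|F x - x| by rewrite normr_gt0 subr_eq0.
near=> y d => y' /circle_proj_eq[m ->] _ /=.
rewrite FZ opprD addrACA subrr addr0; apply: (@le_trans _ _ (`|F x - x| / 2)).
  by near: d; apply: nbhs_right_le; rewrite divr_gt0.
near: y; have cN : (fun y => `|F y - y|) @ x --> `|F x - x|.
  by apply: cvg_norm; apply: cvgB; [exact: cF|exact: cvg_id].
by apply: (cvgr_ge _ cN); lra.
Unshelve. all: by end_near. Qed.

(** At most one lift of f has fixed points, since two lifts differ by an integer;
    its fixed points are exactly the points above those of f. *)
Definition fixing_lift f F := is_lift f F /\ exists p, F p = p.

(** The translates of a fixed point cut the line into intervals of length 1
    preserved by F, so F cannot move x by a nonzero integer. *)
Lemma fixing_liftP f F x : fixing_lift f F ->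
  Fix f (circle_proj x) <-> F x = x.
Proof.
move=> [LF [p Fp]]; have [_ FZ fF] := LF; have F_le := lift_mono LF.
rewrite /Fix /= fF; split=> [|-> //] /circle_proj_eq[m Fx].
pose p' := p + (Num.floor (x - p))%:~R.
have Fp' : F p' = p' by rewrite FZ Fp.
have p'x : p' <= x by rewrite -lerBrDl floor_le.
have xp' : x < p' + 1%:~R.
  by rewrite -addrA -ltrBlDl -intrD floorD1_gt.
have := p'x; rewrite -F_le Fp' => p'Fx.
have := xp'; rewrite -(leW_mono F_le) FZ Fp' => Fxp'.
have m0 : m = 0.
  have : (`|m|%:~R : R) < 1%:~R.
    rewrite intr_norm ltr_norml; rewrite Fx in p'Fx Fxp'.
    by move: p'x xp' p'Fx Fxp'; rewrite -[1%:~R]/(1 : R); lra.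
  by rewrite ltr_int; lia.
by rewrite Fx m0 addr0.
Qed.
End Lifts.

(** * Rational rotation numbers and fixed points *)

Section Dynamics.
Variable R : realType.
Implicit Types (f : homeo_circle R) (F G : R -> R).

Lemma hfun_expg f n z : (f ^+ n)%g z = iter n f z.
Proof. by elim: n z => // n IHn z; rewrite expgS hmulE IHn. Qed.

Lemma lift_expg f F n : is_lift f F -> is_lift (f ^+ n)%g (iter n F).
Proof.
move=> LF; elim: n => [|n IHn]; first exact: id_lift.
by rewrite expgS; exact: comp_lift.
Qed.

Lemma lift_shift f F (m : int) : is_lift f F ->
  is_lift f (fun x => F x + m%:~R).
Proof.
move=> [[cF [G [cG FK GK]]] FZ fF]; split.
- split; first by move=> x; apply: cvgD; [exact: cF|exact: cvg_cst].
  exists (fun x => G (x - m%:~R)); split.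
  + move=> x; apply: continuous_comp; last exact: cG.
    by apply: cvgB; [exact: cvg_id|exact: cvg_cst].
  + by move=> x; rewrite addrK.
  + by move=> x; rewrite GK subrK.
- by move=> x k; rewrite FZ addrAC.
- by move=> x; rewrite circle_projD.
Qed.

Lemma lift_inv f F : is_lift f F ->
  exists G, [/\ is_lift (f^-1)%g G, cancel F G & cancel G F].
Proof.
move=> [[cF [G [cG FK GK]]] FZ fF]; exists G; split=> //; split.
- by split=> //; exists F.
- by move=> x m; rewrite -[in LHS](GK x) -FZ FK.
- move=> x; rewrite -[in LHS](GK x) -fF; exact: hfunK.
Qed.

Lemma iter_drift F (c d x : R) n :
    (forall i, (i < n)%N -> d <= c * (F (iter i F x) - iter i F x)) ->
  n%:R * d <= c * (iter n F x - x).
Proof.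
elim: n => [|n IHn] dF; first by rewrite mul0r subrr mulr0.
have /= := dF n (ltnSn n); have := IHn (fun i lin => dF i (ltnW lin)).
by rewrite -natr1; nra.
Qed.

(** By the intermediate value theorem the displacement has constant sign; c is that
    sign. *)
Lemma displacement_sign F : continuous F -> (forall p, F p <> p) ->
  exists2 c, `|c| = 1 & forall x, `|F x - x| = c * (F x - x).
Proof.
move=> cF nfix; have F_neq x : F x != x by apply/eqP.
have cD : continuous (fun x => F x - x).
  by move=> x; apply: cvgB; [exact: cF|exact: cvg_id].
have no_zero x y : x <= y ->
    ~ (Num.min (F x - x) (F y - y) <= 0 <= Num.max (F x - x) (F y - y)).
  move=> xy /(IVT xy (continuous_subspaceT cD))[p _ /eqP].
  by rewrite subr_eq0 => /eqP /nfix.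
have same x y : x < F x -> F y < y -> False.
  move=> xF Fy; have [xy|/ltW yx] := leP x y.
    by apply: (no_zero _ _ xy); rewrite ge_min le_max; apply/andP; lra.
  by apply: (no_zero _ _ yx); rewrite ge_min le_max; apply/andP; lra.
have [up|nup] := pselect (forall x, x < F x).
  by exists 1; rewrite ?normr1// => x; rewrite mul1r ger0_norm// subr_ge0 ltW.
have [x0 Fx0] : exists x, F x < x.
  have /existsNP[x /negP] := nup; rewrite -leNgt le_eqVlt (negPf (F_neq x)).
  by exists x.
exists (-1); rewrite ?normrN1// => x; rewrite mulN1r ler0_norm// subr_le0 ltW//.
by have := F_neq x; rewrite neq_lt => /orP[//|/same/(_ Fx0)].
Qed.

(** If the lift of f^s with rotation number 0 had no fixed point, its displacement
    would have constant sign and absolute value at least some d > 0, and the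
    rotation number would be at least d in absolute value. *)
Lemma rotation_fixing_lift f (r s : nat) : (0 < s)%N ->
    has_rotation_number f (circle_proj (r%:R / s%:R : R)) ->
  exists G, fixing_lift (f ^+ s)%g G.
Proof.
move=> s0 [F [t [LF Ft /circle_proj_eq[m tE]]]].
have s0R : 0 < s%:R :> R by rewrite ltr0n.
(* k is the rotation number of the lift F^s; G is F^s corrected by it. *)
pose k : int := r%:Z + s%:Z * m; pose G x := iter s F x + (- k)%:~R.
have LG : is_lift (f ^+ s)%g G by apply: lift_shift; exact: lift_expg.
exists G; split=> //; have [[cG _] GZ _] := LG.
have kE : k%:~R = s%:R * t.
  by rewrite tE /k intrD intrM -!pmulrn mulrDr [s%:R * (_ / _)]mulrC divfK// gt_eqF.
have iterG n x : iter n G x = iter (s * n) F x - n%:R * k%:~R.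
  have [_ FsZ _] := lift_expg s LF.
  elim: n => [|n IHn]; first by rewrite muln0 mul0r subr0.
  rewrite iterS IHn /G -[n%:R]/(n%:Z%:~R) -intrM -mulrNz FsZ mulnS iterD.
  rewrite -addrA -intrD -[n.+1%:R]/(n.+1%:Z%:~R) -intrM -mulrNz.
  by congr (_ + _%:~R); lia.
apply: contrapT => /forallNP nfix.
have [d d0 dG] := displacement_ge LG ltr01.
have {}dG x : d <= `|G x - x|.
  by apply: dG => -[? [? [_ [p /= /(nfix p)]]]].
have [c c1 cE] := displacement_sign cG nfix.
have drift n : n%:R * d <= `|iter n G 0|.
  have /iter_drift : forall i, (i < n)%N ->
      d <= c * (G (iter i G 0) - iter i G 0).
    by move=> i _; rewrite -cE.
  move=> /le_trans; apply.
  by rewrite subr0 (le_trans (ler_norm _))// normrM c1 mul1r.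
have /cvgr_dist_lt/(_ (d / s%:R)) := Ft 0.
rewrite divr_gt0// => /(_ isT)[N _ /(_ (s * N.+1)%N)] /=.
have -> : (N <= s * N.+1)%N by nia.
have n0 : 0 < N.+1%:R :> R by rewrite ltr0n.
move=> /(_ isT); apply/negP; rewrite -leNgt subr0.
have -> : iter (s * N.+1) F 0 = iter N.+1 G 0 + N.+1%:R * (s%:R * t).
  by rewrite iterG kE subrK.
have -> : t - (iter N.+1 G 0 + N.+1%:R * (s%:R * t)) / (s * N.+1)%:R
    = - (iter N.+1 G 0 / (s%:R * N.+1%:R)).
  by rewrite natrM; field; rewrite nat1r !gt_eqF.
rewrite normrN normrM [`|(_ * _)^-1|]ger0_norm ?invr_ge0 ?mulr_ge0//.
have -> : d / s%:R = (N.+1%:R * d) / (s%:R * N.+1%:R).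
  by field; rewrite nat1r !gt_eqF.
by rewrite ler_wpM2r// invr_ge0 mulr_ge0.
Qed.
End Dynamics.

(** * Orbits accumulate on the fixed points *)

Section NorthSouth.
Variable R : realType.
Implicit Types (f : homeo_circle R) (F G : R -> R).

Lemma Fix_inv f : Fix (f^-1)%g = Fix f.
Proof.
apply/seteqP; split=> z /= fz; rewrite /Fix /=; last by rewrite -{1}fz hfunK.
by rewrite -{1}fz; exact: hinvK.
Qed.

Lemma fixing_lift_inv f F : fixing_lift f F ->
  exists G, [/\ fixing_lift (f^-1)%g G, cancel F G & cancel G F].
Proof.
move=> [/lift_inv[G [LG FK GK]] [p Fp]]; exists G; split=> //.
by split=> //; exists p; rewrite -[in LHS]Fp FK.
Qed.

Lemma fixing_liftE f F : fixing_lift f F ->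
  Fix f = [set circle_proj p | p in [set p | F p = p]].
Proof.
move=> LF; apply/seteqP; split=> [z|_ [p /= Fp <-]]; last exact/(fixing_liftP _ LF).
by have [x _ <-] := circle_proj_surj z => /(fixing_liftP _ LF) Fx; exists x.
Qed.

(** A rising orbit stays between consecutive fixed points, hence in an interval of
    length at most 1.  If both of its ends are e-far from the fixed points then so
    is everything in between, and each of its n steps has length at least d. *)
Lemma climb_le1 f F e d n x : fixing_lift f F ->
    (forall y, ~ fatten (Fix f) e (circle_proj y) -> d <= `|F y - y|) ->
    ~ fatten (Fix f) e (circle_proj x) ->
    ~ fatten (Fix f) e (circle_proj (iter n F x)) ->
    0 < e -> x < F x ->
  n%:R * d <= 1.
Proof.
move=> LF dF x_far Fx_far e0 xF; have [[_ FZ _] [p0 Fp0]] := LF.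
have F_le : {mono F : u v / u <= v} by apply: lift_mono; exact: LF.1.
have iter_le i : {mono iter i F : u v / u <= v}.
  by elim: i => // i IHi u v; rewrite !iterS F_le IHi.
have orbit_le i j : (i <= j)%N -> iter i F x <= iter j F x.
  move=> /subnK<-; elim: (j - i)%N => // k /le_trans; apply.
  by rewrite addSn iterSr iter_le ltW.
have iter_fix i p : F p = p -> iter i F p = p.
  by move=> Fp; elim: i => //= i ->.
have far i : (i <= n)%N -> ~ fatten (Fix f) e (circle_proj (iter i F x)).
  move=> lein /fattenP[p /(fixing_liftP _ LF) Fp].
  have xi : x <= iter i F x := orbit_le 0%N i (leq0n i).
  have xn := orbit_le _ _ lein.
  have [px|xp] := ltP p x.
    move=> pi; apply: x_far; apply/fattenP; exists p.
      exact/(fixing_liftP _ LF).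
    by move: pi; rewrite !ger0_norm ?subr_ge0; lra.
  have xnp : iter n F x <= p by rewrite -(iter_fix n p Fp) iter_le.
  move=> pi; apply: Fx_far; apply/fattenP; exists p.
    exact/(fixing_liftP _ LF).
  by move: pi; rewrite !ler0_norm ?subr_le0; lra.
have : n%:R * d <= 1 * (iter n F x - x).
  apply: iter_drift => i lt_in; rewrite mul1r.
  have := dF _ (far i (ltnW lt_in)).
  by rewrite ger0_norm// subr_ge0 (orbit_le i i.+1).
move/le_trans; apply; rewrite mul1r lerBlDr addrC.
pose p := p0 + (Num.floor (x - p0) + 1)%:~R.
have Fp : F p = p by rewrite FZ Fp0.
have xp : x <= p by rewrite -lerBlDl ltW// floorD1_gt.
have px : p <= x + 1.
  by rewrite /p intrD addrA lerD2r -lerBrDl floor_le.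
by apply: le_trans px; rewrite -(iter_fix n p Fp) iter_le.
Qed.

(** The orbit of z either rises, and [climb_le1] bounds the number of steps between
    two points far from the fixed points, or it falls, and then it is a rising
    orbit of the inverse read backwards. *)
Lemma escape_to_Fix f F e : fixing_lift f F -> 0 < e ->
  exists N, forall n z, (N <= n)%N ->
    fatten (Fix f) e z \/ fatten (Fix f) e ((f ^+ n)%g z).
Proof.
move=> LF e0; have [G [LG FK GK]] := fixing_lift_inv LF.
have [d d0 dF] := displacement_ge LF.1 e0; rewrite -(fixing_liftE LF) in dF.
have [d' d'0 dG] := displacement_ge LG.1 e0; rewrite -(fixing_liftE LG) in dG.
have F_le : {mono F : u v / u <= v} by apply: lift_mono; exact: LF.1.
have iter_lt i : {mono iter i F : u v / u < v}.
  by apply: leW_mono; elim: i => // i IHi u v; rewrite !iterS F_le IHi.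
pose m := Num.min d d'; have m0 : 0 < m by rewrite lt_min d0.
exists (Num.truncn m^-1).+1 => n z Nn; have [x _ <-] := circle_proj_surj z.
have nm : 1 < n%:R * m.
  rewrite -ltr_pdivrMr// div1r; apply: lt_le_trans (truncnS_gt _) _.
  by rewrite ler_nat.
have [md md'] : m <= d /\ m <= d' by rewrite !ge_min !lexx orbT.
have n0 : 0 <= n%:R :> R by [].
apply: contrapT => /not_orP[]; rewrite hfun_expg.
have -> : iter n f (circle_proj x) = circle_proj (iter n F x).
  by have [_ _ <-] := lift_expg n LF.1; rewrite hfun_expg.
move=> x_far Fx_far; have [xF|Fx|Fx] := ltgtP x (F x).
- by have := climb_le1 LF dF x_far Fx_far e0 xF; nra.
- have iterG y : iter n G (iter n F y) = y.
    by elim: n {Nn nm n0 Fx_far} => // i IHi; rewrite iterSr iterS FK.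
  rewrite -(Fix_inv f) in x_far Fx_far.
  have := climb_le1 (n := n) LG dG Fx_far; rewrite iterG => /(_ x_far e0).
  by rewrite -(leW_mono F_le) GK -iterS iterSr iter_lt => /(_ Fx); nra.
- by apply: x_far; apply: fatten_self => //; apply/(fixing_liftP _ LF).
Qed.

Lemma closedC_Fix f F : fixing_lift f F -> closedC (Fix f).
Proof.
move=> LF; have [[[cF _] _ _] _] := LF.
rewrite /closedC (_ : _ @^-1` _ = (fun x => F x - x) @^-1` [set 0]).
  apply: preimage_closed; last exact: closed_eq.
  by move=> x _; apply: cvgB; [exact: cF|exact: cvg_id].
apply/seteqP; split=> x /=; first by move/(fixing_liftP _ LF) => ->; rewrite subrr.
by move/eqP; rewrite subr_eq0 => /eqP Fx; apply/(fixing_liftP _ LF).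
Qed.
End NorthSouth.

(** * A neighbourhood displaced by all nontrivial powers *)

Section Displaced.
Variable R : realType.
Implicit Types (a : homeo_circle R) (P : set (circle R)).

Lemma near_bounded (T : Type) (F : set_system T) (Phi : nat -> T -> Prop) M :
    Filter F -> (forall i, \forall e \near F, Phi i e) ->
  \forall e \near F, forall i, (i < M)%N -> Phi i e.
Proof.
move=> FF Phi_near; elim: M => [|M]; first exact: nearW.
apply: filterS2 (Phi_near M) => e PhiM PhiltM i.
by rewrite ltnS leq_eqVlt => /orP[/eqP->|/PhiltM].
Qed.

(** Natural exponents suffice: that a^m displaces a set from itself is a symmetric
    property of a^m and its inverse. *)
Lemma fatten_displaced a q G P : (0 < q)%N -> fixing_lift (a ^+ q)%g G ->
    closedC P ->
    (forall m z, (a ^+ m <> 1)%g -> P z -> ~ P ((a ^+ m)%g z)) ->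
  \forall e \near 0^'+, forall m z, (a ^+ m <> 1)%g ->
    fatten P e z -> ~ fatten P e ((a ^+ m)%g z).
Proof.
move=> q0 LG cP aP; have bounded M : \forall e \near 0^'+, forall m, (m < M)%N ->
    (a ^+ m <> 1)%g -> forall z, fatten P e z -> ~ fatten P e ((a ^+ m)%g z).
  apply: near_bounded => m; have [am1|am1] := pselect ((a ^+ m = 1)%g).
    exact: nearW.
  have := fatten_disjoint cP cP (fun z => aP m z am1).
  by apply: filterS => e + _.
(* If a^q = 1 the exponent only matters modulo q. *)
have [aq1|aq1] := pselect ((a ^+ q = 1)%g).
  apply: filterS (bounded q) => e He m z.
  have -> : (a ^+ m = a ^+ (m %% q))%g.
    by rewrite {1}(divn_eq m q) mulnC expgnDr expgnA aq1 expg1n mul1g.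
  by move=> am; apply: He => //; rewrite ltn_pmod.
(* Otherwise the fixed points of a^q form an a-invariant closed set disjoint from
   P, since a^q moves every point of P. *)
have PQ i z : P z -> ~ Fix (a ^+ q)%g ((a ^+ i)%g z).
  rewrite /Fix /= -hmulE -expgnDr addnC expgnDr hmulE => Pz.
  by move/(can_inj (hfunK _)) => az; apply: (aP q z aq1 Pz); rewrite az.
have [e1 e10 sep] := near_right0_ex (near_bounded q _
  (fun i => fatten_disjoint cP (closedC_Fix LG) (PQ i))).
have [N escape] := escape_to_Fix LG e10.
near=> e => m z am; have [mN|Nm] := ltnP m (q * N).
  by move: m mN am z; near: e; exact: bounded.
have ee1 : e <= e1 by near: e; exact: nbhs_right_le.
move=> /(subset_fatten ee1) Pz /(subset_fatten ee1) Paz.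
(* For large m = q * d + i, the point a^i z or its image a^m z under (a^q)^d is
   close to a fixed point of a^q; neither can be, as z and a^m z are close to P. *)
have /(escape _ ((a ^+ (m %% q))%g z)) : (N <= m %/ q)%N by rewrite leq_divRL// mulnC.
rewrite -hmulE -expgnA -expgnDr mulnC -divn_eq => -[].
  by apply: sep => //; rewrite ltn_pmod.
exact: (sep 0%N q0 ((a ^+ m)%g z)).
Unshelve. all: by end_near. Qed.

End Displaced.

(** * Ping-pong *)

Section FreeProduct.
Variable G : groupType.
Implicit Types (x y : G) (K : set G).

Lemma zpow_neq1 x (j : int) : ~ torsion x -> j != 0 -> zpow x j <> 1%g.
Proof.
case: j => [[|n]|n] // x_inf _ /= xn1; apply: x_inf; exists n.+1; split=> //.
by apply/eqP; rewrite -invg_eq1 xn1.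
Qed.

Lemma free_basis_of_free_product x y K : ~ torsion x -> ~ torsion y ->
  free_product_basis x y K -> free_basis x y K.
Proof.
move=> x_inf y_inf [genK freeK]; split=> // w w0 altw w_neq0.
by apply: freeK => // -[[] j] /w_neq0 j0; exact: zpow_neq1.
Qed.

(** A base point t0 in U fixed by the powers of y replaces the usual conjugation
    of words to a normal form: a word beginning with a power of x sends t0 out of
    U whether or not it ends with a power of y.  A word beginning with a power of
    y is reduced to that case by cancelling this first syllable, which fixes t0. *)
Lemma ping_pong (T : Type) (act : G -> T -> T) x y (U : set T) (t0 : T) :
    (forall t, act 1%g t = t) ->
    (forall g h t, act (g * h)%g t = act g (act h t)) ->
    (forall j t, zpow x j <> 1%g -> U t -> ~ U (act (zpow x j) t)) ->
    (forall j t, zpow y j <> 1%g -> ~ U t -> U (act (zpow y j) t)) ->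
    U t0 -> (forall j, act (zpow y j) t0 = t0) ->
  free_product_basis x y (generated [set x; y]).
Proof.
move=> act1 actM xU yU Ut0 yt0; split=> //.
have cons_value s w :
    word_value x y (s :: w) = (syllable x y s * word_value x y w)%g.
  by rewrite /word_value big_cons.
have nil_value : word_value x y [::] = 1%g by rewrite /word_value big_nil.
(* The induction removes two syllables at a time; n bounds the length. *)
have x_first n j w : (size w <= n)%N -> alternating ((false, j) :: w) ->
    {in (false, j) :: w, forall s, syllable x y s <> 1%g} ->
    ~ U (act (word_value x y ((false, j) :: w)) t0).
  elim: n j w => [|n IHn] j w.
    case: w => // _ _ ntriv; rewrite cons_value nil_value mulg1.
    by apply: xU => //; apply: (ntriv (false, j)); rewrite mem_head.
  move=> size_w altw ntriv; rewrite cons_value actM; apply: xU.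
    by apply: (ntriv (false, j)); rewrite mem_head.
  case: w size_w altw ntriv => [|[[] i] [|[[] k] w]] //=.
  - by rewrite nil_value act1.
  - by rewrite cons_value nil_value mulg1 yt0.
  move=> size_w altw ntriv; rewrite cons_value actM; apply: yU.
    by apply: (ntriv (true, i)); rewrite !inE eqxx orbT.
  apply: IHn => //; first by lia.
  by move=> s sw; apply: ntriv; rewrite 2!inE sw !orbT.
case=> [//|[[] j] w] _ altw ntriv w1; last first.
  by apply: (x_first _ j w (leqnn _)) => //; rewrite w1 act1.
case: w altw ntriv w1 => [|[[] i] w] //= altw ntriv.
  rewrite cons_value nil_value mulg1; apply: (ntriv (true, j)).
  by rewrite mem_head.
rewrite cons_value => /(congr1 (fun g => act g t0)).
rewrite act1 actM -[syllable _ _ _]/(zpow y j) => /(congr1 (act (zpow y j)^-1%g)).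
rewrite -[in RHS](yt0 j) -!actM !mulVg mul1g act1 => wt0.
have : ~ U (act (word_value x y ((false, i) :: w)) t0).
  apply: (x_first _ _ _ (leqnn _)) => // s sw; apply: ntriv.
  by rewrite inE sw orbT.
by rewrite wt0.
Qed.
End FreeProduct.

(** * Powers generating a free product *)

Theorem lemma12 (R : realType) (a b : homeo_circle R) (p q r s : nat)
    (p_lt_q : (p < q)%N) (pq_coprime : coprime p q)
    (r_lt_s : (r < s)%N) (rs_coprime : coprime r s)
    (rot_a : has_rotation_number a (circle_proj (p%:R / q%:R : R)%R))
    (rot_b : has_rotation_number b (circle_proj (r%:R / s%:R : R)%R))
    (b_nontorsion : ~ torsion b)
    (a_moves_Fix : forall (x : circle R) (j : int),
        Fix (b ^+ s)%g x -> zpow a j <> 1%g -> ~ Fix (b ^+ s)%g (zpow a j x)) :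
  exists k : nat, (0 < k)%N /\
    free_product_basis a (b ^+ k)%g (generated [set a; (b ^+ k)%g]%classic) /\
    (~ torsion a ->
       free_basis a (b ^+ k)%g (generated [set a; (b ^+ k)%g]%classic)).
Proof.
have s_gt0 : (0 < s)%N := leq_ltn_trans (leq0n r) r_lt_s.
have q_gt0 : (0 < q)%N := leq_ltn_trans (leq0n p) p_lt_q.
have [A LA] := rotation_fixing_lift q_gt0 rot_a.
have [B LB] := rotation_fixing_lift s_gt0 rot_b.
pose P := Fix (b ^+ s)%g.
have aP m z : (a ^+ m <> 1)%g -> P z -> ~ P ((a ^+ m)%g z).
  by move=> am Pz; apply: (a_moves_Fix z (Posz m)).
have /near_right0_ex[e e0 disp] :=
  fatten_displaced q_gt0 LA (closedC_Fix LB) aP.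
have [N escape] := escape_to_Fix LB e0.
pose k := (s * N.+1)%N; exists k; split; first by rewrite muln_gt0 s_gt0.
have [p0 Bp0] := LB.2; have Pp0 : P (circle_proj p0) by apply/(fixing_liftP _ LB).
have bk_escape n z : ~ fatten P e z -> fatten P e ((b ^+ k ^+ n.+1)%g z).
  have /(escape _ z)[] // : (N <= N.+1 * n.+1)%N by nia.
  by rewrite -2!expgnA mulnA.
have invK (g : homeo_circle R) z : g (g^-1%g z) = z by exact: hinvK.
have free : free_product_basis a (b ^+ k)%g (generated [set a; (b ^+ k)%g]%classic).
  apply: (@ping_pong _ (circle R) (@hfun R) _ _ (fatten P e) (circle_proj p0)) => //.
  (* In both cases below a negative power is handled by reading the statement for
     the positive power from the image point. *)
  - case=> m z am Uz; first exact: disp.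
    move=> /(disp m.+1); rewrite invK; apply=> // am1.
    by apply: am; rewrite /= am1 invg1.
  - case=> [[|n]|n] z //; first by move=> _; exact: bk_escape.
    by move=> _ Uz; apply: contrapT => /(bk_escape n); rewrite invK.
  - exact: fatten_self.
  - have bk_fix n : (b ^+ k ^+ n)%g (circle_proj p0) = circle_proj p0.
      rewrite -expgnA -mulnA expgnA hfun_expg.
      by elim: (N.+1 * n)%N => //= i ->.
    by case=> n /=; [exact: bk_fix|rewrite -[in LHS](bk_fix n.+1); exact: hfunK].
split=> // a_inf; apply: free_basis_of_free_product => // -[n [n0]].
rewrite -expgnA => bkn; apply: b_nontorsion; exists (k * n)%N; split=> //.
by rewrite !muln_gt0 s_gt0 n0.
Qed.
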